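(* Let $E$ be a nonempty set, $\mathcal{E}$ a semi-$\sigma$-algebra on $E$, and let $\nu,\tau$ be $\sigma$-maxitive measures on $\mathcal{E}$. Assume that $\nu$ is finite and absolutely continuous with respect to $\tau$. Then $\tau$ is localizable (resp. $\sigma$-principal) if and only if $\mathcal{E}_+^{\nu}/\tau$ is a complete module (resp. a $\sigma$-principal module) over $\mathbb{R}_+^{\max}$.
   Context: $\mathbb{R}_+^{\max}=(\mathbb{R}_+,\max,\times)$ and $\oplus$ denotes maximum/supremum. A semi-$\sigma$-algebra on $E$ is a collection of subsets of $E$ containing $\emptyset$ and $E$ and closed under countable unions and finite intersections. A $\sigma$-maxitive measure on $\mathcal{E}$ is a map $\nu:\mathcal{E}\to[0,\infty]$ with $\nu(\emptyset)=0$ and $\nu(\bigcup_n G_n)=\bigoplus_n\nu(G_n)$ for every countable family in $\mathcal{E}$; it is finite if it takes only finite values. A subset of $E$ is $\tau$-negligible if it is contained in some $G\in\mathcal{E}$ with $\tau(G)=0$. $\nu$ is absolutely continuous with respect to $\tau$ if $\tau(G)=0$ implies $\nu(G)=0$ for $G\in\mathcal{E}$. A $\sigma$-ideal of $\mathcal{E}$ is a nonempty subcollection $\mathcal{I}\subset\mathcal{E}$ closed under countable unions and such that $G\subset S\in\mathcal{I}$, $G\in\mathcal{E}$ imply $G\in\mathcal{I}$. $\tau$ is localizable if for each $\sigma$-ideal $\mathcal{I}$ of $\mathcal{E}$ there is $L\in\mathcal{E}$ such that $S\setminus L$ is $\tau$-negligible for all $S\in\mathcal{I}$, and such that, whenever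 $G\in\mathcal{E}$ satisfies that $S\setminus G$ is $\tau$-negligible for all $S\in\mathcal{I}$, then $L\setminus G$ is $\tau$-negligible. $\tau$ is $\sigma$-principal if for each $\sigma$-ideal $\mathcal{I}$ of $\mathcal{E}$ there is $L\in\mathcal{I}$ such that $S\setminus L$ is $\tau$-negligible for all $S\in\mathcal{I}$. A map $g:E\to[0,\infty]$ is lsm (lower-semimeasurable) if $\{g>t\}\in\mathcal{E}$ for all $t\in\mathbb{R}_+$. Its Shilkret integral is $\int^{\infty}g\,d\nu=\bigoplus_{t\in\mathbb{R}_+}t\,\nu(g>t)$, and $g$ is $\nu$-integrable if this is finite. $\mathcal{E}_+^{\nu}$ is the set of $\nu$-integrable lsm maps $E\to[0,\infty]$. A map $n\in\mathcal{E}_+^{\nu}$ is $\tau$-negligible if $\{n>0\}$ is $\tau$-negligible. Two maps $f,g\in\mathcal{E}_+^{\nu}$ are equivalent if $f\oplus n=g\oplus n$ for some $\tau$-negligible map $n$; $\langle g\rangle$ denotes the class of $g$, and $\mathcal{E}_+^{\nu}/\tau$ is the quotient set. It is an $\mathbb{R}_+^{\max}$-module with $\langle f\rangle.t=\langle t f\rangle$ and $\langle f\rangle\oplus\langle g\rangle=\langle f\oplus g\rangle$ (order: $\langle f\rangle\leqslant\langle g\rangle$ iff $\{f>g\}$ is $\tau$-negligible). A module $M$ over $\mathbb{R}_+^{\max}$ (ordered by $x\leqslant y\iff x\oplus y=y$) is complete if $x.\bigoplus T=\bigoplus_{t\in T}x.t$ for all $x\in M$ and $T\subset\mathbb{R}_+$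 with supremum, and every upper-bounded subset of $M$ has a supremum. A $\sigma$-ideal of $M$ is a nonempty lower subset $I$ such that the supremum of any countable subset of $I$, when it exists in $M$, belongs to $I$. $M$ is $\sigma$-principal if every upper-bounded $\sigma$-ideal of $M$ is of the form $\{y\in M:y\leqslant x\}$ for some $x\in M$. *)

(* Defs.v *)
From HB Require Import structures.
From mathcomp Require Import all_boot all_order all_algebra.
From mathcomp Require Import all_classical all_reals ereal.
From mathcomp Require Import generic_quotient.

Set Implicit Arguments.
Unset Strict Implicit.
Unset Printing Implicit Defensive.

Import Order.TTheory GRing.Theory Num.Theory.
Local Open Scope classical_set_scope.
Local Open Scope ring_scope.

(* The semiring of nonnegative reals whose ring-scope addition + is the maximum
   and whose multiplication is the usual product. *)
Definition Rmax (R : realType) : Type := {nonneg R}.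

Section RmaxTheory.
Variable R : realType.
Implicit Types s t u : Rmax R.

HB.instance Definition _ := Choice.on (Rmax R).

Definition rmax_val (t : Rmax R) : R := (t : {nonneg R})%:num.
Definition rmax_add s t : Rmax R := (Num.max s%:num t%:num)%:nng.
Definition rmax_mul s t : Rmax R := (s%:num * t%:num)%:nng.
Definition rmax_zero : Rmax R := 0%:nng.
Definition rmax_one : Rmax R := 1%:nng.

Lemma rmax_val_inj : injective rmax_val.
Proof. by move=> s t /= h; apply/val_inj. Qed.

Lemma rmax_val_ge0 t : 0 <= rmax_val t.
Proof. by rewrite /rmax_val. Qed.

Let addA : associative rmax_add.
Proof. by move=> s t u; apply: rmax_val_inj; rewrite /rmax_val /= maxA. Qed.
Let addC : commutative rmax_add.
Proof. by move=> s t; apply: rmax_val_inj; rewrite /rmax_val /= maxC. Qed.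
Let add0 : left_id rmax_zero rmax_add.
Proof.
by move=> s; apply: rmax_val_inj; rewrite /rmax_val /=; apply/max_idPr.
Qed.
Let mulA : associative rmax_mul.
Proof. by move=> s t u; apply: rmax_val_inj; rewrite /rmax_val /= mulrA. Qed.
Let mulC : commutative rmax_mul.
Proof. by move=> s t; apply: rmax_val_inj; rewrite /rmax_val /= mulrC. Qed.
Let mul1 : left_id rmax_one rmax_mul.
Proof. by move=> s; apply: rmax_val_inj; rewrite /rmax_val /= mul1r. Qed.
Let mulDl : left_distributive rmax_mul rmax_add.
Proof.
move=> s t u; apply: rmax_val_inj.
by rewrite /rmax_val /= maxr_pMl.
Qed.
Let mul0 : left_zero rmax_zero rmax_mul.
Proof. by move=> s; apply: rmax_val_inj; rewrite /rmax_val /= mul0r. Qed.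
Let one_neq0 : rmax_one != rmax_zero.
Proof.
apply/eqP => /(congr1 rmax_val); rewrite /rmax_val /= => /eqP.
by rewrite oner_eq0.
Qed.

HB.instance Definition _ := GRing.isNmodule.Build (Rmax R) addA addC add0.
HB.instance Definition _ := GRing.Nmodule_isComNzSemiRing.Build (Rmax R)
  mulA mulC mul1 mulDl mul0 one_neq0.

Lemma rmax_valD s t : rmax_val (s + t) = Num.max (rmax_val s) (rmax_val t).
Proof. by []. Qed.
Lemma rmax_valM s t : rmax_val (s * t) = rmax_val s * rmax_val t.
Proof. by []. Qed.
Lemma rmax_val0 : rmax_val 0 = 0.
Proof. by []. Qed.
Lemma rmax_val1 : rmax_val 1 = 1.
Proof. by []. Qed.

End RmaxTheory.

Arguments rmax_val : simpl never.

Definition mle (M : nmodType) (x y : M) : Prop := x + y = y.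

Lemma mle_rmaxE (R : realType) (s t : Rmax R) :
  mle s t <-> rmax_val s <= rmax_val t.
Proof.
split=> [<-|st]; first by rewrite rmax_valD le_max lexx.
by apply: rmax_val_inj; rewrite rmax_valD; apply/max_idPr.
Qed.

Definition upper_bounded (M : nmodType) (S : set M) : Prop :=
  exists u : M, forall x, S x -> mle x u.

Definition is_sup (M : nmodType) (S : set M) (s : M) : Prop :=
  (forall x, S x -> mle x s) /\
  (forall u, (forall x, S x -> mle x u) -> mle s u).

(* Modules over R_+^max are left semimodules over Rmax R; since Rmax R is
   commutative, t *: x plays the role of the right action x.t. *)
Definition complete_module (R : realType) (M : lSemiModType (Rmax R)) : Prop :=
  (forall (x : M) (T : set (Rmax R)) (s : Rmax R),
      is_sup T s -> is_sup [set t *: x | t in T] (s *: x)) /\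
  (forall S : set M, upper_bounded S -> exists s, is_sup S s).

Definition module_sigma_ideal (M : nmodType) (I : set M) : Prop :=
  [/\ I !=set0,
      forall x y, mle x y -> I y -> I x &
      forall S s, countable S -> S `<=` I -> is_sup S s -> I s].

Definition sigma_principal_module (R : realType) (M : lSemiModType (Rmax R)) :
    Prop :=
  forall I : set M, module_sigma_ideal I -> upper_bounded I ->
    exists x : M, I = [set y | mle y x].

Record semi_sigma_algebra (E : Type) := SemiSigmaAlgebra {
  ssets : set (set E);
  ssets0 : ssets set0;
  ssetsT : ssets setT;
  ssets_bigcup : forall F : nat -> set E,
    (forall n, ssets (F n)) -> ssets (\bigcup_n F n);
  ssetsI : setI_closed ssets
}.

(* As for the measures of the library, the underlying function is total; its
   values outside ssets A are irrelevant. *)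
Record maxitive_measure (R : realType) (E : Type) (A : semi_sigma_algebra E) :=
  MaxitiveMeasure {
  mm_fun :> set E -> \bar R;
  mm_ge0 : forall G, ssets A G -> (0 <= mm_fun G)%E;
  mm0 : mm_fun set0 = 0%E;
  mm_bigcup : forall F : nat -> set E, (forall n, ssets A (F n)) ->
    mm_fun (\bigcup_n F n) = ereal_sup (range (fun n => mm_fun (F n)))
}.

Section MaxitiveMeasures.
Variables (R : realType) (E : Type) (A : semi_sigma_algebra E).
Implicit Types nu tau : maxitive_measure R A.

Definition finite_maxitive nu : Prop := forall G, ssets A G -> (nu G < +oo)%E.

Definition mnegligible tau (N : set E) : Prop :=
  exists G, [/\ ssets A G, N `<=` G & tau G = 0%E].

Definition abs_continuous nu tau : Prop :=
  forall G, ssets A G -> tau G = 0%E -> nu G = 0%E.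

Definition sigma_ideal (I : set (set E)) : Prop :=
  [/\ I `<=` ssets A,
      I !=set0,
      forall F : nat -> set E, (forall n, I (F n)) -> I (\bigcup_n F n) &
      forall G S, ssets A G -> G `<=` S -> I S -> I G].

Definition localizable tau : Prop :=
  forall I, sigma_ideal I -> exists L,
    [/\ ssets A L,
        forall S, I S -> mnegligible tau (S `\` L) &
        forall G, ssets A G -> (forall S, I S -> mnegligible tau (S `\` G)) ->
          mnegligible tau (L `\` G)].

Definition sigma_principal tau : Prop :=
  forall I, sigma_ideal I -> exists L,
    I L /\ forall S, I S -> mnegligible tau (S `\` L).

Definition lsm (g : E -> \bar R) : Prop :=
  forall t : R, 0 <= t -> ssets A [set x | (t%:E < g x)%E].

Definition shilkret nu (g : E -> \bar R) : \bar R :=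
  ereal_sup [set (t%:E * nu [set x | (t%:E < g x)%E])%E | t in [set t : R | 0 <= t]].

Lemma ssetsU (F G : set E) : ssets A F -> ssets A G -> ssets A (F `|` G).
Proof.
by move=> AF AG; rewrite -bigcup2E; apply: ssets_bigcup => -[|[|n]] //=;
  exact: ssets0.
Qed.

Lemma mmU nu (F G : set E) : ssets A F -> ssets A G ->
  nu (F `|` G) = maxe (nu F) (nu G).
Proof.
move=> AF AG; rewrite -bigcup2E mm_bigcup; last first.
  by move=> [|[|n]] //=; exact: ssets0.
apply/eqP; rewrite eq_le; apply/andP; split.
  apply: ge_ereal_sup => _ [[|[|n]] _ <-] /=; rewrite le_max ?lexx ?orbT//.
  by rewrite mm0 mm_ge0.
rewrite ge_max; apply/andP; split; apply: ereal_sup_ubound.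
  by exists 0%N.
by exists 1%N.
Qed.

Lemma le_mm nu (F G : set E) : ssets A F -> ssets A G -> F `<=` G ->
  (nu F <= nu G)%E.
Proof. by move=> AF AG /setUidPr <-; rewrite mmU// le_max lexx. Qed.

Lemma mnegligibleS tau (M N : set E) : M `<=` N ->
  mnegligible tau N -> mnegligible tau M.
Proof. by move=> MN [G [AG NG G0]]; exists G; split=> // x /MN /NG. Qed.

Lemma mnegligible0 tau : mnegligible tau set0.
Proof. by exists set0; split=> //; [exact: ssets0|exact: mm0]. Qed.

Lemma mnegligibleU tau (M N : set E) :
  mnegligible tau M -> mnegligible tau N -> mnegligible tau (M `|` N).
Proof.
move=> [F [AF MF F0]] [G [AG NG G0]]; exists (F `|` G); split.
- exact: ssetsU.
- exact: setUSS.
- by rewrite mmU// F0 G0 maxxx.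
Qed.

End MaxitiveMeasures.

Record eplus (R : realType) (E : Type) (A : semi_sigma_algebra E)
    (nu : maxitive_measure R A) := EPlus {
  ep_fun :> E -> \bar R;
  ep_ge0 : forall x, (0 <= ep_fun x)%E;
  ep_lsm : lsm A ep_fun;
  ep_integrable : (shilkret nu ep_fun < +oo)%E
}.

Section EPlusModule.
Variables (R : realType) (E : Type) (A : semi_sigma_algebra E).
Variable nu : maxitive_measure R A.
Implicit Types (f g h : eplus nu) (t : Rmax R).

Lemma eplusP f g : (forall x, f x = g x) -> f = g.
Proof.
case: f g => [f f0 fl fi] [g g0 gl gi] /= /funext fg; subst g.
by congr EPlus; exact: Prop_irrelevance.
Qed.

HB.instance Definition _ := gen_eqMixin (eplus nu).
HB.instance Definition _ := gen_choiceMixin (eplus nu).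

Lemma ep_le_shilkret f (t : R) : 0 <= t ->
  (t%:E * nu [set x | t%:E < f x] <= shilkret nu f)%E.
Proof. by move=> t0; apply: ereal_sup_ubound; exists t. Qed.

Lemma ep_shilkret_ge0 f : (0 <= shilkret nu f)%E.
Proof. by apply: le_trans (ep_le_shilkret f (lexx 0)); rewrite mul0e. Qed.

Lemma gt_maxE (g h : E -> \bar R) (t : R) :
  [set x | (t%:E < maxe (g x) (h x))%E] =
  [set x | (t%:E < g x)%E] `|` [set x | (t%:E < h x)%E].
Proof.
by apply/seteqP; split=> x /=; rewrite lt_max => /orP.
Qed.

Let zero_ge0 (x : E) : (0 <= cst (0 : \bar R) x)%E. Proof. by []. Qed.

Let zero_gt (t : R) : 0 <= t ->
  [set x : E | (t%:E < cst (0 : \bar R) x)%E] = set0.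
Proof.
by move=> t0; apply/seteqP; split=> x //=; rewrite lte_fin ltNge t0.
Qed.

Let zero_lsm : lsm A (cst (0 : \bar R)).
Proof. by move=> t t0; rewrite zero_gt//; exact: ssets0. Qed.

Let zero_int : (shilkret nu (cst (0 : \bar R)) < +oo)%E.
Proof.
apply: (@le_lt_trans _ _ 0%E) => //.
by apply: ge_ereal_sup => _ [t /= t0 <-]; rewrite zero_gt// mm0 mule0.
Qed.

Definition ep_zero : eplus nu := EPlus zero_ge0 zero_lsm zero_int.

Let add_ge0 f g x : (0 <= maxe (f x) (g x))%E.
Proof. by rewrite le_max ep_ge0. Qed.

Let add_lsm f g : lsm A (fun x => maxe (f x) (g x)).
Proof.
by move=> t t0; rewrite gt_maxE; apply: ssetsU; exact: ep_lsm.
Qed.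

Let add_int f g : (shilkret nu (fun x => maxe (f x) (g x)) < +oo)%E.
Proof.
apply: (@le_lt_trans _ _ (maxe (shilkret nu f) (shilkret nu g))); last first.
  by rewrite gt_max !ep_integrable.
apply: ge_ereal_sup => _ [t /= t0 <-].
rewrite gt_maxE mmU; [|exact: ep_lsm..].
have [_|_] := leP (nu [set x | (t%:E < f x)%E]) (nu _);
  by rewrite le_max !ep_le_shilkret// orbT.
Qed.

Definition ep_add f g : eplus nu :=
  EPlus (@add_ge0 f g) (@add_lsm f g) (add_int f g).

Let scale_ge0 t f x : (0 <= (rmax_val t)%:E * f x)%E.
Proof. by rewrite mule_ge0 ?ep_ge0// lee_fin rmax_val_ge0. Qed.

Let scale_gt t f (s : R) : 0 < rmax_val t ->
  [set x | (s%:E < (rmax_val t)%:E * f x)%E] =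
  [set x | ((s / rmax_val t)%:E < f x)%E].
Proof.
by move=> t0; apply/seteqP; split=> x /=; rewrite muleC EFinM lte_pdivrMr.
Qed.

Let scale0_gt t f : rmax_val t = 0 ->
  (fun x => ((rmax_val t)%:E * f x)%E) = cst 0%E.
Proof. by move=> ->; apply/funext => x; rewrite mul0e. Qed.

Let scale_lsm t f : lsm A (fun x => ((rmax_val t)%:E * f x)%E).
Proof.
have [t0|t0] := eqVneq (rmax_val t) 0.
  by rewrite scale0_gt//; exact: zero_lsm.
have {}t0 : 0 < rmax_val t by rewrite lt0r t0 rmax_val_ge0.
by move=> s s0; rewrite scale_gt//; apply: ep_lsm; rewrite divr_ge0// ltW.
Qed.

Let scale_int t f : (shilkret nu (fun x => ((rmax_val t)%:E * f x)%E) < +oo)%E.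
Proof.
have [t0|t0] := eqVneq (rmax_val t) 0.
  by rewrite scale0_gt//; exact: zero_int.
have {}t0 : 0 < rmax_val t by rewrite lt0r t0 rmax_val_ge0.
apply: (@le_lt_trans _ _ ((rmax_val t)%:E * shilkret nu f)%E); last first.
  by rewrite lte_mul_pinfty ?ep_integrable// lee_fin ltW.
apply: ge_ereal_sup => _ [s /= s0 <-]; rewrite scale_gt//.
rewrite -[X in (X%:E * _)%E](@divfK _ (rmax_val t)) ?gt_eqF//.
rewrite mulrC EFinM -muleA lee_pmul2l// ?lte_fin//.
by apply: ep_le_shilkret; rewrite divr_ge0// ltW.
Qed.

Definition ep_scale t f : eplus nu :=
  EPlus (@scale_ge0 t f) (@scale_lsm t f) (scale_int t f).

Let addA : associative ep_add.
Proof. by move=> f g h; apply: eplusP => x /=; rewrite maxA. Qed.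
Let addC : commutative ep_add.
Proof. by move=> f g; apply: eplusP => x /=; rewrite maxC. Qed.
Let add0 : left_id ep_zero ep_add.
Proof. by move=> f; apply: eplusP => x /=; apply/max_idPr; exact: ep_ge0. Qed.

HB.instance Definition _ := GRing.isNmodule.Build (eplus nu) addA addC add0.

Let scalerA s t f : ep_scale s (ep_scale t f) = ep_scale (s * t) f.
Proof. by apply: eplusP => x; rewrite /= muleA rmax_valM EFinM. Qed.
Let scale0r f : ep_scale 0 f = 0.
Proof. by apply: eplusP => x /=; rewrite rmax_val0 mul0e. Qed.
Let scale1r : left_id 1 ep_scale.
Proof. by move=> f; apply: eplusP => x /=; rewrite rmax_val1 mul1e. Qed.
Let scalerDr : right_distributive ep_scale +%R.
Proof.
by move=> t f g; apply: eplusP => x /=; rewrite maxe_pMr// lee_fin rmax_val_ge0.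
Qed.
Let scalerDl f : {morph ep_scale^~ f : s t / s + t}.
Proof.
move=> s t; apply: eplusP => x /=; rewrite rmax_valD.
have [st|/ltW ts] := leP (rmax_val s) (rmax_val t); apply/esym.
  by apply/max_idPr; rewrite lee_wpmul2r ?ep_ge0// lee_fin.
by apply/max_idPl; rewrite lee_wpmul2r ?ep_ge0// lee_fin.
Qed.

HB.instance Definition _ := GRing.Nmodule_isLSemiModule.Build (Rmax R)
  (eplus nu) scalerA scale0r scale1r scalerDr scalerDl.

Lemma ep_addE f g x : (f + g) x = maxe (f x) (g x).
Proof. by []. Qed.
Lemma ep_zeroE x : (0 : eplus nu) x = 0%E.
Proof. by []. Qed.
Lemma ep_scaleE t f x : (t *: f) x = ((rmax_val t)%:E * f x)%E.
Proof. by []. Qed.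

End EPlusModule.

Section Quotient.
Variables (R : realType) (E : Type) (A : semi_sigma_algebra E).
Variables (nu tau : maxitive_measure R A).
Implicit Types (f g h n : eplus nu) (t : Rmax R).

Definition ep_negligible n : Prop := mnegligible tau [set x | (0 < n x)%E].


Definition ep_equiv f g : Prop := exists2 n, ep_negligible n & f + n = g + n.

Lemma ep_negligibleD m n :
  ep_negligible m -> ep_negligible n -> ep_negligible (m + n).
Proof.
by move=> m0 n0; rewrite /ep_negligible gt_maxE; exact: mnegligibleU.
Qed.

Lemma ep_negligibleZ t n : ep_negligible n -> ep_negligible (t *: n).
Proof.
apply: mnegligibleS => x /=; apply: contraTT; rewrite -!leNgt => nx.
have -> : n x = 0%E by apply/eqP; rewrite eq_le nx ep_ge0.
by rewrite mule0.
Qed.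

Let equivb f g : bool := `[< ep_equiv f g >].

Let equivb_refl : reflexive equivb.
Proof.
move=> f; apply/asboolP; exists 0 => //; rewrite /ep_negligible.
by apply: mnegligibleS (mnegligible0 tau) => x /=; rewrite ltxx.
Qed.
Let equivb_sym : symmetric equivb.
Proof.
by move=> f g; apply/asboolP/asboolP => -[n n0 fg]; exists n.
Qed.
Let equivb_trans : transitive equivb.
Proof.
move=> g f h /asboolP[m m0 fg] /asboolP[n n0 gh]; apply/asboolP.
exists (m + n); first exact: ep_negligibleD.
by rewrite addrA fg -addrA [m + n]addrC !addrA gh.
Qed.

Definition ep_equiv_rel : equiv_rel (eplus nu) :=
  EquivRel (fun f g => `[< ep_equiv f g >])
    equivb_refl equivb_sym equivb_trans.

Definition eplus_quot : Type := {eq_quot ep_equiv_rel}%qT.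

HB.instance Definition _ := Choice.on eplus_quot.
HB.instance Definition _ := EqQuotient.on eplus_quot.

Definition ep_class (f : eplus nu) : eplus_quot := (\pi_eplus_quot f)%qT.

Lemma ep_classP f g : ep_class f = ep_class g <-> ep_equiv f g.
Proof.
by split=> [/eqP|fg]; [rewrite eqmodE => /asboolP|
  apply/eqP; rewrite eqmodE; apply/asboolP].
Qed.

Lemma ep_class_repr (u : eplus_quot) : ep_class (repr u) = u.
Proof. exact: reprK. Qed.

Definition epq_add (u v : eplus_quot) : eplus_quot :=
  ep_class (repr u + repr v).
Definition epq_scale t (u : eplus_quot) : eplus_quot :=
  ep_class (t *: repr u).

Let classD f g : ep_class (f + g) = epq_add (ep_class f) (ep_class g).
Proof.
apply/ep_classP.
have /ep_classP[m m0 em] := esym (ep_class_repr (ep_class f)).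
have /ep_classP[n n0 en] := esym (ep_class_repr (ep_class g)).
exists (m + n); first exact: ep_negligibleD.
by rewrite addrACA em en addrACA.
Qed.

Let classZ t f : ep_class (t *: f) = epq_scale t (ep_class f).
Proof.
apply/ep_classP.
have /ep_classP[m m0 em] := esym (ep_class_repr (ep_class f)).
exists (t *: m); first exact: ep_negligibleZ.
by rewrite -!scalerDr em.
Qed.

Let addA : associative epq_add.
Proof.
move=> u v w; rewrite -(ep_class_repr u) -(ep_class_repr v) -(ep_class_repr w).
by rewrite -!classD addrA.
Qed.
Let addC : commutative epq_add.
Proof. by move=> u v; rewrite /epq_add addrC. Qed.
Let add0 : left_id (ep_class 0) epq_add.
Proof. by move=> u; rewrite -(ep_class_repr u) -classD add0r. Qed.

HB.instance Definition _ := GRing.isNmodule.Build eplus_quot addA addC add0.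

Let scalerA s t (u : eplus_quot) :
  epq_scale s (epq_scale t u) = epq_scale (s * t) u.
Proof. by rewrite -(ep_class_repr u) -!classZ scalerA. Qed.
Let scale0r (u : eplus_quot) : epq_scale 0 u = 0.
Proof. by rewrite /epq_scale scale0r. Qed.
Let scale1r : left_id 1 epq_scale.
Proof. by move=> u; rewrite /epq_scale scale1r ep_class_repr. Qed.
Let scalerDr : right_distributive epq_scale +%R.
Proof.
move=> t u v; rewrite -(ep_class_repr u) -(ep_class_repr v).
have D f g : ep_class f + ep_class g = ep_class (f + g) by exact: esym (classD f g).
by rewrite D -!classZ D scalerDr.
Qed.
Let scalerDl (u : eplus_quot) : {morph epq_scale^~ u : s t / s + t}.
Proof.
move=> s t; rewrite /epq_scale scalerDl; exact: classD.
Qed.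

HB.instance Definition _ := GRing.Nmodule_isLSemiModule.Build (Rmax R)
  eplus_quot scalerA scale0r scale1r scalerDr scalerDl.

Lemma ep_classD f g : ep_class (f + g) = ep_class f + ep_class g.
Proof. exact: classD. Qed.
Lemma ep_classZ t f : ep_class (t *: f) = t *: ep_class f.
Proof. exact: classZ. Qed.

(* The order of the quotient module, in terms of representatives. *)
Lemma mle_ep_class f g : abs_continuous nu tau ->
  mle (ep_class f) (ep_class g) <-> mnegligible tau [set x | (g x < f x)%E].
Proof.
move=> nutau; rewrite /mle -ep_classD ep_classP; split.
- move=> [n n0 e]; apply: mnegligibleS n0 => x /= gf.
  have /= := congr1 (fun h : eplus nu => h x) e.
  rewrite -maxA (maxC (g x)) => ex.
  rewrite ltNge; apply/negP => nx.
  have n0 : n x = 0%E by apply/eqP; rewrite eq_le nx ep_ge0.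
  move: ex; rewrite n0 (max_idPr (ep_ge0 g x)) (max_idPl (ltW gf)).
  by move=> fg; rewrite fg ltxx in gf.
- move=> [G [AG sG G0]].
  pose k x : \bar R := if x \in G then +oo%E else 0%E.
  have kE (t : R) : 0 <= t -> [set x | (t%:E < k x)%E] = G.
    move=> t0; apply/seteqP; split=> x /=; rewrite /k.
      by case: ifP => [/set_mem//|_]; rewrite lte_fin ltNge t0.
    by move=> Gx; rewrite mem_set// ltry.
  have k0 x : (0 <= k x)%E by rewrite /k; case: ifP.
  have kl : lsm A k by move=> t t0; rewrite kE.
  have ki : (shilkret nu k < +oo)%E.
    apply: (@le_lt_trans _ _ 0%E) => //.
    apply: ge_ereal_sup => _ [t /= t0 <-].
    by rewrite kE// nutau// mule0.
  exists (EPlus k0 kl ki); first by exists G; split=> //; rewrite -(kE 0).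
  apply: eplusP => x; rewrite !ep_addE /= /k; case: ifPn => Gx.
    by rewrite !maxey.
  have /max_idPr -> // : (f x <= g x)%E.
  by rewrite leNgt; apply: contra Gx => fg; apply/mem_set/sG.
Qed.

End Quotient.

(* Main.v *)
(* Sets and functions are exchanged through level sets. A set [G] becomes the
   class of its indicator, which lies in [eplus_quot nu tau] because [nu] is
   finite, and the order on indicators is inclusion up to null sets; this gives
   both implications towards [tau]. Conversely, a family of classes yields, for
   each term [q n] of a dense sequence of nonnegative reals, a sigma-ideal
   attached to its level sets [{q n < f}]; the sets [L n] chosen by the property
   of [tau] give in the localizable case the supremum [sup_n q_n 1_{L n}], and in
   the sigma-principal case a sequence of members of the ideal whose supremum is
   its largest element. Only countably many null sets are discarded, and
   integrability of the suprema comes from the upper bound by absolute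
   continuity. *)
Require Import Defs.
From mathcomp Require Import all_boot all_order all_algebra.
From mathcomp Require Import all_classical all_reals.
From mathcomp Require Import ereal.
Import Order.TTheory GRing.Theory Num.Theory.
Local Open Scope classical_set_scope.

Set Implicit Arguments.
Unset Strict Implicit.
Unset Printing Implicit Defensive.

(** * A countable dense set of nonnegative levels *)

Section DenseSequence.
Variable R : realType.
Local Open Scope ring_scope.

(** Absolute values of an enumeration of the rationals; an index coding no rational gives [0]. *)
Definition dense_seq (n : nat) : R := `|ratr (odflt 0 (unpickle n) : rat)|.

Lemma dense_seq_ge0 n : 0 <= dense_seq n.
Proof. exact: normr_ge0. Qed.

Lemma dense_seq_between (a b : \bar R) : (0 <= a)%E -> (a < b)%E ->
  exists n, (a < (dense_seq n)%:E)%E /\ ((dense_seq n)%:E < b)%E.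
Proof.
case: a => [a|_|] //; last by rewrite ltNge leey.
rewrite lee_fin => a0 ab.
(* A real [c] replaces [b], which may be [+oo]. *)
have [c [ac cb]] : exists c : R, a < c /\ (c%:E <= b)%E.
  case: b ab => [b|_|] //; first by rewrite lte_fin => ab; exists b; rewrite lexx.
  by exists (a + 1); rewrite ltrDl ltr01 leey.
have [r] := rat_in_itvoo ac.
rewrite in_itv /= => /andP[ar rc]; exists (pickle r).
rewrite /dense_seq pickleK /= ger0_norm ?(le_trans a0 (ltW ar))//.
by rewrite lte_fin ar; split=> //; apply: lt_le_trans cb; rewrite lte_fin.
Qed.

End DenseSequence.

Lemma countable_range (T : Type) (S : set T) : countable S -> S !=set0 ->
  exists F : nat -> T, S = range F.
Proof.
move=> /pfcard_geP[->|[F]] [x Sx]; first by [].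
by exists F; rewrite image_eq.
Qed.

(** * The order of a module *)

Section Nmodule.
Variable M : nmodType.
Local Open Scope ring_scope.

Lemma mle_trans (x y z : M) : mle x y -> mle y z -> mle x z.
Proof. by rewrite /mle => xy <-; rewrite addrA xy. Qed.

Lemma mle0 (x : M) : mle 0 x.
Proof. exact: add0r. Qed.

End Nmodule.

(** Idempotency of addition is inherited from the scalars, where [1 + 1 = 1]. *)
Lemma mle_refl (R : realType) (M : lSemiModType (Rmax R)) (x : M) : mle x x.
Proof.
rewrite /mle -(scale1r x) -scalerDl; congr (_ *: _)%R.
by apply: rmax_val_inj; rewrite rmax_valD maxxx.
Qed.

(** * Null sets, countable suprema and step functions *)

Section MaxitiveMeasures.
Variables (R : realType) (E : Type) (A : semi_sigma_algebra E).
Implicit Types nu tau : maxitive_measure R A.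
Local Open Scope ereal_scope.

Lemma mnegligible_bigcup tau (N : nat -> set E) :
  (forall n, mnegligible tau (N n)) -> mnegligible tau (\bigcup_n N n).
Proof.
move=> /choice[G NG]; exists (\bigcup_n G n); split.
- by apply: ssets_bigcup => n; have [] := NG n.
- by apply: subset_bigcup => n _; have [] := NG n.
- rewrite mm_bigcup; last by move=> n; have [] := NG n.
  have -> : (fun n => tau (G n)) = cst 0.
    by apply/funext => n; have [] := NG n.
  rewrite (_ : range _ = [set 0]) ?ereal_sup1//.
  by apply/seteqP; split=> [_ [n _ <-]|_ ->] //; exists 0%N.
Qed.

Lemma ereal_sup_gtE (F : nat -> E -> \bar R) (t : R) :
  [set x | t%:E < ereal_sup (range (F^~ x))] =
  \bigcup_n [set x | t%:E < F n x].
Proof.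
apply/seteqP; split=> x /=.
  by move=> /ereal_sup_gt[_ [n _ <-] tF]; exists n.
move=> [n _ /= tF]; apply: (lt_le_trans tF).
by apply: ereal_sup_ubound; exists n.
Qed.

Lemma lsm_ereal_sup (F : nat -> E -> \bar R) : (forall n, lsm A (F n)) ->
  lsm A (fun x => ereal_sup (range (F^~ x))).
Proof.
move=> lF t t0; rewrite ereal_sup_gtE; apply: ssets_bigcup => n.
exact: lF.
Qed.

(** The exceptional set lies in some [G] that is null for [tau], hence for [nu]; adjoining [G] to
    [{t < u}] keeps its [nu]-value and makes it contain [{t < f}]. *)
Lemma integrable_le nu tau (f : E -> \bar R) (u : eplus nu) :
  abs_continuous nu tau -> lsm A f -> mnegligible tau [set x | u x < f x] ->
  shilkret nu f < +oo.
Proof.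
move=> nutau lf [G [AG fG G0]]; apply: le_lt_trans (ep_integrable u).
apply: ge_ereal_sup => _ [t /= t0 <-].
apply: le_trans (ep_le_shilkret u t0); rewrite lee_wpmul2l ?lee_fin//.
have -> : nu [set x | t%:E < u x] = nu ([set x | t%:E < u x] `|` G).
  rewrite mmU//; last exact: ep_lsm.
  by rewrite (nutau _ AG G0) (max_idPl _)// mm_ge0//; exact: ep_lsm.
apply: le_mm; [exact: lf|by apply: ssetsU => //; exact: ep_lsm|].
move=> x /= tf; have [uf|fu] := ltP (u x) (f x); first by right; exact: fG.
by left; exact: lt_le_trans fu.
Qed.

Definition step_fun (c : R) (G : set E) (x : E) : \bar R :=
  if x \in G then c%:E else 0.

Lemma step_fun_ge0 c G x : (0 <= c)%R -> 0 <= step_fun c G x.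
Proof. by rewrite /step_fun; case: ifP. Qed.

Lemma step_fun_gt c G (t : R) : (0 <= t)%R ->
  [set x | t%:E < step_fun c G x] = if (t < c)%R then G else set0.
Proof.
move=> t0; apply/seteqP; split=> x /=; rewrite /step_fun.
  case: ifPn => [/set_mem Gx|_]; last by rewrite lte_fin ltNge t0.
  by rewrite lte_fin => ->.
by case: ifPn => // tc Gx; rewrite mem_set.
Qed.

Lemma lsm_step_fun c G : ssets A G -> lsm A (step_fun c G).
Proof.
by move=> AG t t0; rewrite step_fun_gt//; case: ifP => // _; exact: ssets0.
Qed.

Lemma integrable_step_fun nu c G : finite_maxitive nu -> (0 <= c)%R ->
  ssets A G -> shilkret nu (step_fun c G) < +oo.
Proof.
move=> nufin c0 AG; apply: (@le_lt_trans _ _ (c%:E * nu G)).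
  apply: ge_ereal_sup => _ [t /= t0 <-]; rewrite step_fun_gt//.
  case: ifPn => [/ltW tc|_]; first by rewrite lee_wpmul2r ?mm_ge0.
  by rewrite mm0 mule0 mule_ge0 ?mm_ge0.
by rewrite lte_mul_pinfty ?nufin.
Qed.

Lemma step_fun_diff (S G : set E) :
  S `\` G `<=` [set x | step_fun 1 G x < step_fun 1 S x].
Proof. by move=> x [Sx Gx]; rewrite /= /step_fun (memNset Gx) (mem_set Sx) lte01. Qed.

End MaxitiveMeasures.

(** * Order and suprema in the quotient module *)

Section Quotient.
Variables (R : realType) (E : Type) (A : semi_sigma_algebra E).
Variables (nu tau : maxitive_measure R A).
Hypothesis nutau : abs_continuous nu tau.
Implicit Types (f g u : eplus nu).
Local Open Scope ereal_scope.
Let q := @dense_seq R.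
Local Notation cl := (@ep_class R E A nu tau).

Let cl_ind (P : eplus_quot nu tau -> Prop) : (forall f, P (cl f)) ->
  forall x, P x.
Proof. by move=> Pf x; rewrite -(ep_class_repr x). Qed.

(* If [g x < f x], some [q n] lies strictly in between, so [x] is in
   [{q n < f}] but not in [L n]. *)
Lemma mle_ep_class_dense f g (L : nat -> set E) :
  (forall n x, L n x -> (q n)%:E <= g x) ->
  (forall n, mnegligible tau ([set x | (q n)%:E < f x] `\` L n)) ->
  mle (cl f) (cl g).
Proof.
move=> Lg /mnegligible_bigcup fL; apply/mle_ep_class => //.
apply: mnegligibleS fL => x /= gf.
have [n [gq qf]] := dense_seq_between (ep_ge0 g x) gf.
by exists n => //; split=> // /Lg; rewrite leNgt gq.
Qed.

Lemma mle_ep_class_gt f g (t : R) : mle (cl f) (cl g) ->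
  mnegligible tau ([set x | t%:E < f x] `\` [set x | t%:E < g x]).
Proof.
move=> /(mle_ep_class _ _ nutau); apply: mnegligibleS => x [/= tf /negP].
by rewrite -leNgt => gt; apply: le_lt_trans tf.
Qed.

Lemma ep_sup (F : nat -> E -> \bar R) u : (forall n x, 0 <= F n x) ->
  (forall n, lsm A (F n)) ->
  (mnegligible tau [set x | u x < ereal_sup (range (F^~ x))]) ->
  exists f : eplus nu, forall x, f x = ereal_sup (range (F^~ x)).
Proof.
move=> F0 lF Fu.
have f0 x : 0 <= ereal_sup (range (F^~ x)).
  by apply: le_trans (F0 0%N x) _; apply: ereal_sup_ubound; exists 0%N.
have lf := lsm_ereal_sup lF.
by exists (EPlus f0 lf (integrable_le nutau lf Fu)).
Qed.

(** The pointwise supremum of representatives works, since a countable union of null sets is null.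
    The last clause lets level sets of [f] be handled termwise. *)
Lemma is_sup_ep_class (F : nat -> eplus nu) u :
  (forall n, mle (cl (F n)) (cl u)) ->
  exists f, [/\ forall n x, F n x <= f x,
    is_sup (range (cl \o F)) (cl f) &
    forall t : R, [set x | t%:E < f x] = \bigcup_n [set x | t%:E < F n x]].
Proof.
have supE v : [set x | v x < ereal_sup (range ((F : nat -> E -> \bar R)^~ x))]
    `<=` \bigcup_n [set x | v x < F n x].
  by move=> x /= /ereal_sup_gt[_ [n _ <-] vF]; exists n.
have sup_negl v : (forall n, mle (cl (F n)) (cl v)) ->
    mnegligible tau
      [set x | v x < ereal_sup (range ((F : nat -> E -> \bar R)^~ x))].
  move=> Fv; apply: mnegligibleS (supE v) _; apply: mnegligible_bigcup => n.
  exact/mle_ep_class.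
move=> Fu; have [|||f fE] := @ep_sup F u.
- by move=> n x; exact: ep_ge0.
- by move=> n; exact: ep_lsm.
- exact: sup_negl.
have Ff n x : F n x <= f x by rewrite fE; apply: ereal_sup_ubound; exists n.
exists f; split=> //.
- split=> [_ [n _ <-]|].
    apply/mle_ep_class => //; apply: mnegligibleS (mnegligible0 tau) => x /=.
    by rewrite ltNge Ff.
  elim/cl_ind => v Fv; apply/mle_ep_class => //.
  rewrite (_ : mkset _ = [set x | v x <
    ereal_sup (range ((F : nat -> E -> \bar R)^~ x))]); last first.
    by apply/seteqP; split=> x /=; rewrite fE.
  by apply: sup_negl => n; apply: Fv; exists n.
- move=> t; rewrite -(ereal_sup_gtE (F : nat -> E -> \bar R)).
  by apply/seteqP; split=> x /=; rewrite fE.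
Qed.

Lemma is_sup_scale (x : eplus_quot nu tau) (T : set (Rmax R)) (s : Rmax R) :
  is_sup T s -> is_sup [set (t *: x)%R | t in T] (s *: x)%R.
Proof.
move=> [Ts sT]; split=> [_ [t Tt <-]|].
  by rewrite /mle -scalerDl (Ts _ Tt).
elim/cl_ind: x => f; elim/cl_ind => u fu.
(* [T] may be uncountable, so a sequence approaching [s] is extracted: if [q n < s], then [q n] is
   not an upper bound of [T] and some [t] in [T] exceeds it; otherwise [0] is a harmless default. *)
have /choice[t tP] n : exists t : Rmax R,
    (T t \/ t = 0%R) /\ ((q n < rmax_val s)%R -> (q n < rmax_val t)%R).
  have [qs|sq] := ltP (q n) (rmax_val s); last by exists 0%R; split; [right|].
  apply: contrapT => noT; have : mle s (NngNum (dense_seq_ge0 R n)).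
    apply: sT => t Tt; apply/mle_rmaxE; rewrite leNgt; apply/negP => qt.
    by apply: noT; exists t; split=> //; left.
  by move/mle_rmaxE; rewrite leNgt => /negP; apply.
have : mnegligible tau (\bigcup_n [set x | u x < (t n *: f)%R x]).
  apply: mnegligible_bigcup => n; apply/mle_ep_class => //; rewrite ep_classZ.
  by have [[Tt|->] _] := tP n; [apply: fu; exists (t n)|rewrite scale0r; exact: mle0].
rewrite -ep_classZ; move=> neg; apply/mle_ep_class => //.
apply: mnegligibleS neg => x /= us.
(* For finite [f x], pick [q n] between [u x / f x] and [s]; for infinite [f x], any level strictly
   between [0] and [s] will do. *)
have [n un] : exists n, u x < (q n)%:E * f x /\ (q n < rmax_val s)%R.
  have u0 := ep_ge0 u x; have f0 := ep_ge0 f x; have s0 := rmax_val_ge0 s.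
  move: us f0; case: (f x) => [r| |] //.
    rewrite lee_fin => us r0.
    have {}r0 : (0 < r)%R.
      rewrite lt0r r0 andbT; apply/negP => /eqP r0'.
      by move: us; rewrite r0' mule0 ltNge u0.
    have [] := @dense_seq_between R (u x * (r^-1)%:E) (rmax_val s)%:E.
    - by rewrite mule_ge0// lee_fin invr_ge0 ltW.
    - by rewrite lte_pdivrMr.
    - move=> n [un ns]; exists n; split; last by rewrite -lte_fin.
      by rewrite -lte_pdivrMr.
  move=> us _.
  have {}s0 : (0 < rmax_val s)%R.
    rewrite lt0r s0 andbT; apply/negP => /eqP s0'.
    by move: us; rewrite s0' mul0e ltNge u0.
  have [|n [n0 ns]] := @dense_seq_between R 0 (rmax_val s)%:E (lexx _).
    by rewrite lte_fin.
  exists n; split; last by rewrite -lte_fin.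
  by rewrite gt0_muley//; move: us; rewrite gt0_muley// lte_fin.
exists n => //=; case: un => un /(proj2 (tP n)) qt.
apply: lt_le_trans un _; apply: lee_wpmul2r; first exact: ep_ge0.
by rewrite lee_fin ltW.
Qed.

(** * From [tau] to the module *)

Lemma localizable_complete : localizable tau ->
  complete_module (eplus_quot nu tau).
Proof.
move=> loc; split; first exact: is_sup_scale.
move=> S []; elim/cl_ind => u Su.
(* [I n] collects the sets lying below every essential upper bound of the
   family [{q n < f}], [cl f] in [S]. *)
pose bound n H := ssets A H /\
  forall f, S (cl f) -> mnegligible tau ([set x | (q n)%:E < f x] `\` H).
pose I n := [set G | ssets A G /\
  forall H, bound n H -> mnegligible tau (G `\` H)].
have /(fun h => choice (fun n => loc _ (h n)))[L LP] n : sigma_ideal A (I n).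
  split.
  - by move=> G [].
  - exists set0; split; first exact: ssets0.
    by move=> H _; rewrite set0D; exact: mnegligible0.
  - move=> F IF; split; first by apply: ssets_bigcup => k; have [] := IF k.
    move=> H bH; rewrite setD_bigcupl; apply: mnegligible_bigcup => k.
    by have [_] := IF k; apply.
  - move=> G F AG GF [_ IF]; split=> // H /IF.
    by apply: mnegligibleS; exact: setSD.
(* Each [{q n < f}] with [cl f] in [S] belongs to [I n], so [L n] is an essential bound; as any
   other bound also bounds [I n], [L n] is the least one. *)
have boundL n : bound n (L n).
  have [AL IL _] := LP n; split=> // f Sf; apply: IL; split.
    exact/ep_lsm/dense_seq_ge0.
  by move=> H [_]; exact.
have L_least n H : bound n H -> mnegligible tau (L n `\` H).
  move=> bH; have [_ _] := LP n; apply; first by case: bH.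
  by move=> F [_]; exact.
pose F n := step_fun (q n) (L n).
have F_least v : (forall f, S (cl f) -> mle (cl f) (cl v)) ->
    mnegligible tau [set x | v x < ereal_sup (range (F^~ x))].
  (* An upper bound [v] makes [{q n < v}] an essential bound at level [q n], so minimality of [L n]
     applies. *)
  move=> Sv; have neg n : mnegligible tau (L n `\` [set x | (q n)%:E < v x]).
    apply: L_least; split; first exact/ep_lsm/dense_seq_ge0.
    by move=> f /Sv; exact: mle_ep_class_gt.
  apply: mnegligibleS (mnegligible_bigcup neg) => x /=.
  move=> /ereal_sup_gt[_ [n _ <-]]; rewrite /F /step_fun.
  case: ifPn => [/set_mem Lx vq|_]; last by rewrite ltNge ep_ge0.
  by exists n => //; split=> //=; apply/negP; rewrite -leNgt ltW.
have [|||g gE] := @ep_sup F u.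
- by move=> n x; apply/step_fun_ge0/dense_seq_ge0.
- by move=> n; apply: lsm_step_fun; have [] := LP n.
- by apply: F_least => f; exact: Su.
exists (cl g); split.
  elim/cl_ind => f Sf; apply: (@mle_ep_class_dense _ _ L) => n.
    move=> x Lx; rewrite gE; apply: ereal_sup_ubound; exists n => //.
    by rewrite /F /step_fun mem_set.
  by have [_] := boundL n; apply.
elim/cl_ind => v Sv; apply/mle_ep_class => //.
have -> : (g : E -> \bar R) = fun x => ereal_sup (range (F^~ x)) by exact/funext.
by apply: F_least => f; exact: Sv.
Qed.

Lemma sigma_principal_tau_module : sigma_principal tau ->
  sigma_principal_module (eplus_quot nu tau).
Proof.
move=> princ J [[j0 Jj0] Jle Jsup] []; elim/cl_ind => u Ju.
(* The bound [u] makes countable suprema exist, and the ideal then contains them. *)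
have seq_sup (F : nat -> eplus nu) : (forall n, J (cl (F n))) ->
    exists f, [/\ forall n x, F n x <= f x, J (cl f) &
      forall t : R, [set x | t%:E < f x] = \bigcup_n [set x | t%:E < F n x]].
  move=> JF; have [|f [Ff fsup fE]] := @is_sup_ep_class F u.
    by move=> n; exact: Ju.
  exists f; split=> //; apply: Jsup fsup; first exact: card_image_le.
  by move=> _ [n _ <-]; exact: JF.
pose I n := [set G | ssets A G /\
  exists2 f, J (cl f) & G `<=` [set x | (q n)%:E < f x]].
have /(fun h => choice (fun n => princ _ (h n)))[L LP] n : sigma_ideal A (I n).
  split.
  - by move=> G [].
  - exists set0; split; first exact: ssets0.
    by exists (repr j0) => //; rewrite ep_class_repr.
  - move=> F IF; split; first by apply: ssets_bigcup => k; have [] := IF k.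
    have /choice[f fP] k : exists f : eplus nu,
        J (cl f) /\ F k `<=` [set x | (q n)%:E < f x].
      by have [_ [f]] := IF k; exists f.
    have [k|g [_ Jg gE]] := @seq_sup f; first by have [] := fP k.
    exists g => //; rewrite gE; apply: subset_bigcup => k _.
    by have [] := fP k.
  - move=> G F AG GF [_ [f Jf Ff]]; split=> //; exists f => //.
    exact: subset_trans Ff.
(* Membership of [L n] in [I n] supplies a member of the ideal exceeding [q n] on [L n]; the
   supremum [g] of these will be the largest element. *)
have /choice[f fP] n : exists f : eplus nu,
    J (cl f) /\ L n `<=` [set x | (q n)%:E < f x].
  by have [[_ [f Jf Lf]] _] := LP n; exists f.
have [n|g [fg Jg _]] := @seq_sup f; first by have [] := fP n.
exists (cl g); apply/seteqP; split; last by move=> y; move/Jle; apply.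
elim/cl_ind => h Jh; apply: (@mle_ep_class_dense _ _ L) => n.
  move=> x Lx; apply: le_trans (fg n x).
  by have [_ Lf] := fP n; exact/ltW/Lf.
have [_] := LP n; apply; split; first exact/ep_lsm/dense_seq_ge0.
by exists h.
Qed.

(** * From the module back to [tau] *)

Hypothesis nufin : finite_maxitive nu.

(* The indicator of [G], with the junk value [0] when [G] is not in [A]. *)
Definition ep_indic (G : set E) : eplus nu :=
  if pselect (ssets A G) is left AG then
    EPlus (fun x => step_fun_ge0 G x ler01) (lsm_step_fun _ AG)
      (integrable_step_fun nufin ler01 AG)
  else 0%R.

Lemma ep_indicE G : ssets A G -> ep_indic G = step_fun 1 G :> (E -> \bar R).
Proof. by rewrite /ep_indic; case: pselect. Qed.

Lemma mle_ep_indic F G : ssets A F -> ssets A G ->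
  mle (cl (ep_indic F)) (cl (ep_indic G)) <-> mnegligible tau (F `\` G).
Proof.
move=> AF AG; rewrite mle_ep_class// !ep_indicE//; split.
  exact/mnegligibleS/step_fun_diff.
apply: mnegligibleS => x /=; rewrite /step_fun.
case: ifPn => [_|/negP]; case: ifPn => [/set_mem Fx|_]; rewrite ?ltxx//.
- by rewrite lte_fin ltr10.
- by move=> Gx _; split=> // /mem_set.
Qed.

Lemma complete_localizable : complete_module (eplus_quot nu tau) ->
  localizable tau.
Proof.
move=> [_ complete] I [IA _ _ _].
have [] := complete [set cl (ep_indic G) | G in I].
  exists (cl (ep_indic setT)) => _ [G /IA AG <-].
  apply/mle_ep_indic => //; first exact: ssetsT.
  by rewrite setDT; exact: mnegligible0.
elim/cl_ind => h [hub hle].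
(* The support of the supremum of the indicators is the required set: [h] need not itself be an
   indicator. *)
exists [set x | 0 < h x]; split.
- exact: ep_lsm.
- move=> S IS; have AS := IA _ IS.
  have /(mle_ep_class _ _ nutau) : mle (cl (ep_indic S)) (cl h).
    by apply: hub; exists S.
  apply: mnegligibleS => x [Sx /negP]; rewrite -leNgt /= ep_indicE// => hx.
  by apply: le_lt_trans hx _; rewrite /step_fun mem_set// lte01.
- move=> G AG SG.
  have /(mle_ep_class _ _ nutau) : mle (cl h) (cl (ep_indic G)).
    by apply: hle => _ [S IS <-]; apply/mle_ep_indic; auto.
  apply: mnegligibleS => x [hx Gx] /=.
  by rewrite ep_indicE// /step_fun memNset.
Qed.

Lemma sigma_principal_module_tau :
  sigma_principal_module (eplus_quot nu tau) -> sigma_principal tau.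
Proof.
move=> princ I [IA [G0 IG0] Icup Ile].
(* The lower set generated by the indicators of [I]; closure of [I] under countable unions makes it
   a sigma-ideal. *)
pose J := [set y | exists2 G, I G & mle y (cl (ep_indic G))].
have IJ G : I G -> J (cl (ep_indic G)).
  move=> IG; exists G => //; apply/mle_ep_indic; [exact: IA..|].
  by rewrite setDv; exact: mnegligible0.
have [||x Jx] := princ J.
- split.
  + by exists (cl (ep_indic G0)); exact: IJ.
  + by move=> y z yz [G IG zG]; exists G => //; exact: mle_trans zG.
  + move=> S s cS SJ [Ss sS].
    (* The empty family has no enumeration; its supremum is below [0], so any member of [I]
       serves. *)
    have [S0|/set0P] := eqVneq S set0.
      exists G0 => //; apply: mle_trans (mle0 _); apply: sS => y.
      by rewrite S0.
    move=> /(countable_range cS)[F SF].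
    have /choice[G GP] n : exists G, I G /\ mle (F n) (cl (ep_indic G)).
      have [G IG FG] : J (F n) by apply: SJ; rewrite SF; exists n.
      by exists G.
    have IG n : I (G n) by have [] := GP n.
    exists (\bigcup_n G n); first exact: Icup.
    apply: sS => y; rewrite SF => -[n _ <-].
    have [_ Gn] := GP n; apply: mle_trans Gn _.
    apply/mle_ep_indic; [exact: IA|exact/IA/Icup|].
    rewrite (_ : _ `\` _ = set0); first exact: mnegligible0.
    by rewrite -subset0 => z [Gz]; apply; exists n.
- exists (cl (ep_indic setT)) => y [G /IA AG]; move/mle_trans; apply.
  apply/mle_ep_indic => //; first exact: ssetsT.
  by rewrite setDT; exact: mnegligible0.
(* The largest element [x] lies in [J], hence below the indicator of some [L] in [I], which then
   dominates all of [I]. *)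
have [L IL xL] : J x by rewrite Jx /=; exact: mle_refl.
exists L; split=> // S IS; apply/mle_ep_indic; [exact: IA..|].
by have := IJ _ IS; rewrite Jx => Sx; exact: mle_trans xL.
Qed.

End Quotient.

Theorem proposition6p2 (R : realType) (E : Type) (A : semi_sigma_algebra E)
    (nu tau : maxitive_measure R A) (E_nonempty : [set: E] !=set0)
    (nu_finite : finite_maxitive nu) (nu_ac_tau : abs_continuous nu tau) :
  (localizable tau <-> complete_module (eplus_quot nu tau)) /\
  (sigma_principal tau <-> sigma_principal_module (eplus_quot nu tau)).
Proof.
split; split.
- exact: localizable_complete.
- exact: complete_localizable.
- exact: sigma_principal_tau_module.
- exact: sigma_principal_module_tau.
Qed.
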